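(* Let $V\subseteq\mathbb{N}_0^n$ be nonempty and, for each $1\le i\le n$, let $(\mathcal{G}^{(i)}_n,m_i)=(V,E^{(i)}_n)\in\mathscr{X}(V)$ be generalized directed semi-trees such that, for some natural number $k$, $\mathrm{card}(\mathrm{Par}^{(i)}_n(\mathbf{v}))\le k$ for all $\mathbf{v}\in V$ and $1\le i\le n$. Let $p_i$ be the polynomial associated to $(\mathcal{G}^{(i)}_n,m_i)$, let $\{S_{\mathbf v}\}_{\mathbf v\in V}$ be a family of polynomials satisfying (i) and (ii) of the context, let $\{\beta(\mathbf v)\}_{\mathbf v\in V}$ be positive numbers, and let $\mathscr{H}^2(\beta)$ and $T_{p_i}$ be the corresponding Hilbert space of formal power series and multiplication operators. Then, for $i=1,\dots,n$, the operator $T_{p_i}$ is bounded on $\mathscr{H}^2(\beta)$ if and only if $$\sup_{\mathbf v\in V}\ \sum_{\mathbf u\in\mathrm{Chi}^{(i)}_n(\mathbf v)}\frac{\beta(\mathbf u)^2}{\beta(\mathbf v)^2}<\infty .$$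
   Context: $\mathbb{N}$ is the set of natural numbers (positive integers) and $\mathbb{N}_0=\mathbb{N}\cup\{0\}$. A directed graph is $(V,E)$ with $E\subseteq(V\times V)\setminus\{(v,v):v\in V\}$; $\mathrm{Chi}(u)=\{v:(u,v)\in E\}$, $\mathrm{Par}(u)=\{v:(v,u)\in E\}$. It is a generalized directed semi-tree if it has no circuit (distinct vertices $v_1,\dots,v_r$, $r\ge2$, with $(v_j,v_{j+1})\in E$ for $j<r$ and $(v_r,v_1)\in E$), has at most countably many connected components, and there is a non-negative integer $l$ with $\mathrm{card}(\mathrm{Chi}(u)\cap\mathrm{Chi}(v))\le l$ for all distinct $u,v$; it is denoted $(\mathcal{G},l)$ with $l$ the least such integer. For $V\subseteq\mathbb{N}_0^n$, $\mathscr{X}(V)$ is the set of generalized directed semi-trees $(\mathcal{G},l)=(V,E)$ such that: (1) if $(\mathbf v,\mathbf u)\in E$ then $v_j\le u_j$ for $j=1,\dots,n$; (2) there is a natural number $m$ with $\mathrm{card}(\mathrm{Chi}(\mathbf u))\le m$ for all $\mathbf u\in V$ and $V_m=\{\mathbf v\in V:\mathrm{card}(\mathrm{Chi}(\mathbf v))=m\}\neq\emptyset$, such that (a) for any $\mathbf v,\mathbf v'\in V_m$ and $\mathbf u\in\mathrm{Chi}(\mathbf v)$ there is a unique $\mathbf u'\in\mathrm{Chi}(\mathbf v')$ with $\mathbf u-\mathbf v=\mathbf u'-\mathbf v'$; hence the set $\deg(\mathcal{G})=\{\mathbf u-\mathbf v:\mathbf u\in\mathrm{Chi}(\mathbf v)\}=\{\mathbf{k}^{(1)},\dots,\mathbf{k}^{(m)}\}$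 does not depend on $\mathbf v\in V_m$; (b) for every $\mathbf u\in V$ and $\mathbf w\in\mathrm{Chi}(\mathbf u)$ there is a unique $\mathbf k\in\deg(\mathcal{G})$ with $\mathbf w-\mathbf u=\mathbf k$. The polynomial associated to $(\mathcal{G},l)$ is $p_{\mathcal{G}}(z_1,\dots,z_n)=\sum_{i=1}^m z_1^{k^{(i)}_1}\cdots z_n^{k^{(i)}_n}$. For $(\mathcal{G}^{(i)}_n,m_i)=(V,E^{(i)}_n)$, write $\mathrm{Chi}^{(i)}_n(\mathbf v)$ and $\mathrm{Par}^{(i)}_n(\mathbf v)$ for the sets of children and parents of $\mathbf v$, and $p_i$ for the associated polynomial. The polynomials $S_{\mathbf v}$, $\mathbf v\in V$, are required to satisfy: (i) $S_{\mathbf v}=\sum_{|\mathbf a|\le|\mathbf v|,\ \mathbf a\in\mathbb{N}_0^n}c_{\mathbf a}\,p_1^{a_1}\cdots p_n^{a_n}$ for some $c_{\mathbf a}\in\mathbb{C}$ (depending on $\mathbf v$), where $|\mathbf a|=\sum_i a_i$; (ii) $p_i\cdot S_{\mathbf v}=\sum_{\mathbf u\in\mathrm{Chi}^{(i)}_n(\mathbf v)}S_{\mathbf u}$ for all $i$ and $\mathbf v$. $\mathscr{H}^2(\beta)$ is the Hilbert space of formal series $f=\sum_{\mathbf v\in V}\hat f(\mathbf v)S_{\mathbf v}$ with $\sum_{\mathbf v}|\hat f(\mathbf v)|^2\beta(\mathbf v)^2<\infty$ and inner product $\langle f,g\rangle=\sum_{\mathbf v}\hat f(\mathbf v)\overline{\hat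 g(\mathbf v)}\beta(\mathbf v)^2$; thus $\{S_{\mathbf v}/\beta(\mathbf v)\}$ is an orthonormal basis. The operator $T_{p_i}f=p_if$ is formal multiplication using (ii), that is, $T_{p_i}f=\sum_{\mathbf v\in V}\big(\sum_{\mathbf u\in\mathrm{Par}^{(i)}_n(\mathbf v)}\hat f(\mathbf u)\big)S_{\mathbf v}$. Bounded on $\mathscr{H}^2(\beta)$ means that it maps $\mathscr{H}^2(\beta)$ into itself as a bounded operator. *)

(* Defs.v *)
From HB Require Import structures.
From mathcomp Require Import all_boot all_order all_algebra.
From mathcomp Require Import complex.
From mathcomp Require Import mpoly.
From mathcomp Require Import boolp classical_sets functions cardinality fsbigop.
From mathcomp Require Import reals ereal esum.

Set Implicit Arguments.
Unset Strict Implicit.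
Unset Printing Implicit Defensive.

Import Order.TTheory GRing.Theory Num.Theory.

Local Open Scope card_scope.
Local Open Scope classical_set_scope.
Local Open Scope ring_scope.

(* Cardinality bounds are stated with [A #<= `I_k] ("card A <= k", which
   includes finiteness of A) and [A #= `I_k] ("card A = k"). *)

Section DirectedGraphs.
Variable T : choiceType.
Implicit Types (E : set (T * T)) (u v : T) (l : nat).

Definition Chi E u : set T := [set v | E (u, v)].
Definition Par E u : set T := [set v | E (v, u)].

Definition circuit E (s : seq T) : Prop :=
  [/\ (2 <= size s)%N, uniq s & cycle [rel u v | (u, v) \in E] s].

(* Connectedness is that of the underlying undirected graph. *)
Definition connected_vertices E u v : Prop :=
  exists s : seq T,
    path [rel x y | ((x, y) \in E) || ((y, x) \in E)] u s /\ last u s = v.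

Definition component E u : set T := [set v | connected_vertices E u v].

Definition common_children_le E l : Prop :=
  forall u v, u <> v -> (Chi E u `&` Chi E v) #<= `I_l.

(* (T, E) is a generalized directed semi-tree, denoted (G, l), where l is the
   least bound on the number of common children of two distinct vertices. *)
Definition gen_dir_semitree E l : Prop :=
  [/\ forall v, ~ E (v, v),
      forall s, ~ circuit E s,
      countable (range (component E)),
      common_children_le E l
    & forall l', common_children_le E l' -> (l <= l')%N].

Definition is_max_outdegree E (m : nat) : Prop :=
  (forall u, Chi E u #<= `I_m) /\ (exists v, Chi E v #= `I_m).

(* the set V_m *)
Definition full_vertices E (m : nat) : set T := [set v | Chi E v #= `I_m].

(* the unique m such that [is_max_outdegree E m], if there is one *)
Definition max_outdegree E : nat := get [set m | is_max_outdegree E m].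

End DirectedGraphs.

Section ClassX.
Variables (n : nat) (V : set 'X_{1..n}).
Implicit Types (E : set (V * V)) (l m : nat).

(* The subtraction of multi-indices [_ - _]%MM is truncated.  It is only applied
   to the endpoints of an edge, where, by the first clause of [class_X], it is
   the actual difference. *)
Definition edge_diff (v u : V) : 'X_{1..n} := (val u - val v)%MM.

Definition deg_graph E m : set 'X_{1..n} :=
  [set k | exists v u : V,
     [/\ full_vertices E m v, Chi E v u & k = edge_diff v u]].

(* (V, E), with overlap bound l, belongs to the class X(V). *)
Definition class_X E l : Prop :=
  [/\ gen_dir_semitree E l,
      forall v u : V, E (v, u) -> forall j : 'I_n, (val v j <= val u j)%N
    & exists m : nat,
      [/\ (0 < m)%N,
          is_max_outdegree E m,
          forall v v' : V, full_vertices E m v -> full_vertices E m v' ->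
            forall u, Chi E v u ->
              exists! u', Chi E v' u' /\ edge_diff v u = edge_diff v' u'
        & forall u w : V, Chi E u w ->
            exists! k, deg_graph E m k /\ edge_diff u w = k]].

Definition assoc_poly (R : realType) E : {mpoly R[i][n]} :=
  \sum_(k \in deg_graph E (max_outdegree E)) 'X_[R[i], k].

End ClassX.

Section PolynomialFamily.
Variables (R : realType) (n : nat) (V : set 'X_{1..n}).
Variable E : 'I_n -> set (V * V).
Variable S : V -> {mpoly R[i][n]}.

(* [a] ranges over the multi-indices with |a| <= |v| *)
Definition family_degree_cond : Prop :=
  forall v : V, exists c : 'X_{1..n} -> R[i],
    S v = \sum_(a : 'X_{1..n < (mdeg (val v)).+1})
            c a *: \prod_(i < n) assoc_poly R (E i) ^+ (a : 'X_{1..n}) i.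

Definition family_mul_cond : Prop :=
  forall (i : 'I_n) (v : V),
    assoc_poly R (E i) * S v = \sum_(u \in Chi (E i) v) S u.

End PolynomialFamily.

(* A formal series \sum_v f(v) S_v is represented by its family of coefficients
   f : T -> R[i], where T is the type of vertices. *)
Section WeightedHardySpace.
Variables (R : realType) (T : choiceType) (beta : T -> R).
Implicit Types f g : T -> R[i].

(* <f, f> = \sum_v |f(v)|^2 beta(v)^2, possibly infinite *)
Definition sqnorm f : \bar R :=
  \esum_(v in [set: T]) (ComplexField.Normc.normc (f v) ^+ 2 * beta v ^+ 2)%:E.

Definition H2 : set (T -> R[i]) := [set f | (sqnorm f < +oo)%E].

Definition H2norm f : R := Num.sqrt (fine (sqnorm f)).

Definition bounded_on_H2 (A : (T -> R[i]) -> (T -> R[i])) : Prop :=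
  [/\ forall f, H2 f -> H2 (A f),
      forall (a : R[i]) f g, H2 f -> H2 g ->
        A (fun v => a * f v + g v) = (fun v => a * A f v + A g v)
    & exists M : R, forall f, H2 f -> H2norm (A f) <= M * H2norm f].

End WeightedHardySpace.

(* Formal multiplication by the polynomial of the graph E, on coefficients.
   The sum is meaningful when [Par E v] is finite. *)
Definition mul_op (R : realType) (T : choiceType) (E : set (T * T))
    (f : T -> R[i]) : T -> R[i] :=
  fun v => \sum_(u \in Par E v) f u.

(* Main.v *)
Require Import Defs.
From HB Require Import structures.
From mathcomp Require Import all_boot all_order all_algebra.
From mathcomp Require Import complex.
From mathcomp Require Import mpoly.
From mathcomp Require Import boolp classical_sets functions cardinality fsbigop.
From mathcomp Require Import reals ereal esum.

Set Implicit Arguments.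
Unset Strict Implicit.
Unset Printing Implicit Defensive.

Import Order.TTheory GRing.Theory Num.Theory.

Local Open Scope card_scope.
Local Open Scope classical_set_scope.
Local Open Scope ring_scope.

(** On coefficients, multiplication by [p_i] is a shift along the edges of the
    [i]-th graph: it sends [f] to the family [v |-> \sum_(u in Par v) f u].  Its
    boundedness is therefore a statement about one directed graph with
    uniformly bounded numbers of parents and with finite sets of children
    ([bounded_mul_op_iff]).

    If the operator has norm at most [M], test it on the series reduced to the
    single term [S_u].  Its image is the sum of the [S_v] over the children [v]
    of [u] ([mul_op_indicator1]), and the square norms of the two series are
    [beta u ^+ 2] and [\sum_(v in Chi u) beta v ^+ 2] ([sqnorm_indicator]), so
    [M ^+ 2] bounds every quotient.

    Conversely, if [C] bounds the quotients and each vertex has at most [k]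
    parents, the Cauchy-Schwarz inequality ([normc_fsum_sqr_le]) bounds the
    coefficient of the image at [v] by
    [|\sum_(u in Par v) f u|^2 <= k * \sum_(u in Par v) |f u|^2].  Multiply
    by [beta v ^+ 2] and sum over [v]: the right-hand side is a sum over all
    edges, which may be grouped by their sources instead of their targets
    ([esum_edges]); grouped in this way it is at most
    [k * C * \sum_u |f u|^2 * beta u ^+ 2] ([sqnorm_mul_op_le]).  The norm of
    the operator is thus at most the square root of [k * C]. *)

(** Both sides sum over the edges, grouped by target on the left and by source
    on the right; the terms being nonnegative, the grouping is immaterial. *)
Lemma esum_edges (R : realType) (T : choiceType) (E : set (T * T))
    (a : T -> T -> \bar R) : (forall u v, 0 <= a u v)%E ->
  (\esum_(v in [set: T]) \esum_(u in Par E v) a u v =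
   \esum_(u in [set: T]) \esum_(v in Chi E u) a u v)%E.
Proof.
move=> a0; rewrite !esum_esum//.
rewrite (reindex_esum ([set: T] `*`` Chi E) _ (fun e => (e.2, e.1)))//.
split=> [[u v]|[u v] [u' v'] _ _ [-> ->]|[v u]]//=.
by move=> [_ vu]; exists (u, v).
Qed.

Lemma esumZl_le (R : realType) (T : choiceType) (I : set T) (c : R)
    (a : T -> \bar R) : 0 <= c -> (forall x, 0 <= a x)%E ->
  (\esum_(x in I) (c%:E * a x) <= c%:E * \esum_(x in I) a x)%E.
Proof.
move=> c0 a0; apply: ge_ereal_sup => _ [X IX <-].
rewrite -ge0_mule_fsumr//; apply: lee_wpmul2l; first by rewrite lee_fin.
by apply: ereal_sup_ubound; exists X.
Qed.

(** The Cauchy-Schwarz inequality against the constant family 1, obtained by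
    adding up [2 * a x * a y <= a x ^+ 2 + a y ^+ 2] over all pairs of
    indices. *)
Lemma sqr_sum_le (R : realDomainType) (I : Type) (s : seq I) (a : I -> R) :
  (\sum_(x <- s) a x) ^+ 2 <= (size s)%:R * \sum_(x <- s) a x ^+ 2.
Proof.
rewrite -(@ler_pMn2r _ 2)// expr2 big_distrlr/=.
have -> : (size s)%:R * (\sum_(x <- s) a x ^+ 2) *+ 2 =
    \sum_(x <- s) \sum_(y <- s) (a x ^+ 2 + a y ^+ 2).
  under [RHS]eq_bigr do
    rewrite big_split/= big_const_seq count_predT iter_addr_0 -mulr_natl.
  rewrite big_split/= -mulr_sumr big_const_seq count_predT iter_addr_0.
  by rewrite mulr2n mulr_natl.
rewrite -sumrMnl; apply: ler_sum => x _.
rewrite -sumrMnl; apply: ler_sum => y _.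
by rewrite -subr_ge0 -addrAC -sqrrB sqr_ge0.
Qed.

Local Notation normc := ComplexField.Normc.normc.

Lemma normc_ge0 (R : rcfType) (z : R[i]) : 0 <= normc z.
Proof. by case: z => x y; exact: sqrtr_ge0. Qed.

Lemma normc_fsum_sqr_le (R : rcfType) (T : choiceType) (D : set T) (k : nat)
    (f : T -> R[i]) : D #<= `I_k ->
  normc (\sum_(x \in D) f x) ^+ 2 <= k%:R * \sum_(x \in D) normc (f x) ^+ 2.
Proof.
move=> Dk; have Dfin : finite_set D by apply/finite_set_leP; exists k.
rewrite !fsbig_finite//=; set s := finmap.enum_fset _.
have triangle : normc (\sum_(x <- s) f x) <= \sum_(x <- s) normc (f x).
  elim/big_rec2: _ => [|x y z _ IH]; first by rewrite ComplexField.Normc.normc0.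
  by apply: le_trans (le_normcD _ _) _; rewrite lerD2l.
apply: le_trans (_ : (\sum_(x <- s) normc (f x)) ^+ 2 <= _).
  by rewrite ler_sqr// nnegrE ?sumr_ge0// => *; exact: normc_ge0.
apply: le_trans (sqr_sum_le _ _) _.
rewrite ler_wpM2r ?ler_nat ?geq_card_fset_set//.
by apply: sumr_ge0 => x _; exact: sqr_ge0.
Qed.

Section WeightedShift.
Variables (R : realType) (T : choiceType) (beta : T -> R) (E : set (T * T)).
Implicit Types f : T -> R[i].

Lemma sqnorm_ge0 f : (0 <= sqnorm beta f)%E.
Proof. by apply: esum_ge0 => v _; rewrite lee_fin mulr_ge0 ?sqr_ge0. Qed.

(** With [A] a singleton this evaluates the norm of a single [S_u], and with
    [A] the children of [u] the norm of its image under multiplication. *)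
Lemma sqnorm_indicator (A : set T) : finite_set A ->
  sqnorm beta (fun v => (v \in A)%:R) = (\sum_(v \in A) beta v ^+ 2)%:E.
Proof.
move=> Afin; rewrite -fsumEFin// -esum_fset//; last first.
  by move=> v _; rewrite lee_fin sqr_ge0.
rewrite [RHS]esum_mkcond; apply: eq_esum => v _; case: (v \in A).
  by rewrite [normc _](ComplexField.Normc.normc1 R) expr1n mul1r.
by rewrite [normc _](ComplexField.Normc.normc0 R) expr0n mul0r.
Qed.

(** This is the multiplication rule for a single [S_u], seen on
    coefficients. *)
Lemma mul_op_indicator1 (u : T) :
  mul_op E (fun v => (v \in [set u])%:R) = (fun v => (v \in Chi E u)%:R : R[i]).
Proof.
apply/funext => v; rewrite /mul_op fsbig_mkcond.
rewrite (fsbigE [:: u])//= => [|w _]; last first.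
  rewrite /patch mem_seq1 => wu; rewrite [w \in [set u]]memNset ?if_same//.
  by move=> /= wuE; rewrite wuE eqxx in wu.
rewrite big_cons big_nil addr0 in_setT /patch [u \in [set u]]mem_set//.
have -> : (u \in Par E v) = (v \in Chi E u) by apply/idP/idP; rewrite !inE.
by case: ifP.
Qed.

Lemma mul_op_linear (a : R[i]) f g : (forall v, finite_set (Par E v)) ->
  mul_op E (fun v => a * f v + g v) = (fun v => a * mul_op E f v + mul_op E g v).
Proof.
move=> Pfin; apply/funext => v.
by rewrite /mul_op fsbig_split// -mulr_fsumr.
Qed.

(** The number of parents enters through the Cauchy-Schwarz inequality at each
    target, and the weights of the children through the regrouping of the
    edges by source.  The finiteness of the children turns the inner infinite
    sums into the finite sums of the hypothesis. *)
Lemma sqnorm_mul_op_le (k : nat) (C : R) f : 0 <= C ->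
  (forall v, Par E v #<= `I_k) -> (forall u, finite_set (Chi E u)) ->
  (forall u, \sum_(v \in Chi E u) beta v ^+ 2 <= C * beta u ^+ 2) ->
  (sqnorm beta (mul_op E f) <= (k%:R * C)%:E * sqnorm beta f)%E.
Proof.
move=> C0 Pk Cfin CC.
have ge0 (x y : R) : (0 <= (x ^+ 2 * y ^+ 2)%:E)%E.
  by rewrite lee_fin mulr_ge0 ?sqr_ge0.
(* Cauchy-Schwarz at each vertex [v] leads to this sum over edges. *)
apply: (@le_trans _ _ (\esum_(v in [set: T]) (k%:R%:E *
    \esum_(u in Par E v) (normc (f u) ^+ 2 * beta v ^+ 2)%:E)))%E.
  apply: le_esum => v _; have Pfin : finite_set (Par E v).
    by apply/finite_set_leP; exists k.
  rewrite esum_fset// fsumEFin// -EFinM lee_fin -mulr_fsuml.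
  by rewrite [leRHS]mulrA ler_wpM2r ?sqr_ge0 ?normc_fsum_sqr_le.
apply: le_trans (esumZl_le _ _ _) _ => // [v|]; first exact: esum_ge0.
rewrite EFinM -muleA lee_wpmul2l ?lee_fin// esum_edges//.
apply: le_trans (esumZl_le _ _ _) => //.
apply: le_esum => u _; rewrite esum_fset// fsumEFin// -EFinM lee_fin.
by rewrite -mulr_fsumr mulrCA ler_wpM2l ?sqr_ge0.
Qed.

Lemma bounded_mul_op_iff (k : nat) : (forall v, 0 < beta v) ->
  (forall v, Par E v #<= `I_k) -> (forall u, finite_set (Chi E u)) ->
  bounded_on_H2 beta (mul_op E) <->
  (ereal_sup (range (fun u =>
     (\sum_(v \in Chi E u) (beta v ^+ 2 / beta u ^+ 2))%:E)) < +oo)%E.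
Proof.
move=> beta_gt0 Pk Cfin; set r := fun u => _.
have beta2_gt0 u : 0 < beta u ^+ 2 by rewrite exprn_gt0.
have rE u : r u = ((\sum_(v \in Chi E u) beta v ^+ 2) / beta u ^+ 2)%:E.
  by rewrite mulr_fsuml.
split=> [[_ _ [M AM]]|supr].
  apply: (@le_lt_trans _ _ (M ^+ 2)%:E); last exact: ltry.
  apply: ge_ereal_sup => _ [u _ <-]; rewrite rE lee_fin ler_pdivrMr//.
  (* The test vector is [S_u], with coefficient family the indicator of u. *)
  have sqnorm_u : sqnorm beta (fun v => (v \in [set u])%:R) = (beta u ^+ 2)%:E.
    by rewrite sqnorm_indicator// fsbig_set1.
  have := AM (fun v => (v \in [set u])%:R).
  rewrite /H2 /= /H2norm mul_op_indicator1 sqnorm_u sqnorm_indicator//.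
  move=> /(_ (ltry _)) /=; rewrite sqrtr_sqr gtr0_norm// => le_M.
  rewrite -exprMn -(@sqr_sqrtr _ (\sum_(v \in _) _)).
    by rewrite ler_sqr ?nnegrE ?sqrtr_ge0// (le_trans (sqrtr_ge0 _) le_M).
  by apply: fsumr_ge0 => v _; exact: sqr_ge0.
(* The absolute value makes [C] nonnegative also when there is no vertex, where
   the supremum is [-oo]. *)
pose C := `|fine (ereal_sup (range r))|.
have CP u : \sum_(v \in Chi E u) beta v ^+ 2 <= C * beta u ^+ 2.
  rewrite -ler_pdivrMr// -lee_fin -rE.
  have le_sup : (r u <= ereal_sup (range r))%E.
    by apply: ereal_sup_ubound; exists u.
  apply: (le_trans le_sup); rewrite /C; move: supr le_sup.
  case: (ereal_sup (range r)) => //= x _ _.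
  by rewrite lee_fin ler_norm.
have C_ge0 : 0 <= C by exact: normr_ge0.
have A_le f := sqnorm_mul_op_le f C_ge0 Pk Cfin CP.
have AH2 f : H2 beta f -> H2 beta (mul_op E f).
  move=> Hf; apply: le_lt_trans (A_le f) _.
  have /fineK <- : sqnorm beta f \is a fin_num by rewrite ge0_fin_numE ?sqnorm_ge0.
  by rewrite -EFinM ltry.
split=> // [a f g _ _|].
  by apply: mul_op_linear => v; apply/finite_set_leP; exists k.
have kC_ge0 : 0 <= k%:R * C by rewrite mulr_ge0.
exists (Num.sqrt (k%:R * C)) => f Hf.
have finH2 g : H2 beta g -> sqnorm beta g \is a fin_num.
  by move=> Hg; rewrite ge0_fin_numE ?sqnorm_ge0.
rewrite /H2norm -sqrtrM// ler_wsqrtr// -lee_fin EFinM !fineK ?A_le//.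
  exact: finH2.
by apply/finH2/AH2.
Qed.

End WeightedShift.

Theorem lemma3p3 (R : realType) (n : nat) (n_gt0 : (0 < n)%N)
    (V : set 'X_{1..n}) (V_neq0 : V !=set0)
    (E : 'I_n -> set (V * V)) (l : 'I_n -> nat)
    (EX : forall i, class_X (E i) (l i))
    (k : nat) (k_gt0 : (0 < k)%N)
    (Par_le : forall (i : 'I_n) (v : V), Par (E i) v #<= `I_k)
    (S : V -> {mpoly R[i][n]})
    (S_deg : family_degree_cond E S) (S_mul : family_mul_cond E S)
    (beta : V -> R) (beta_gt0 : forall v, 0 < beta v) :
  forall i : 'I_n,
    bounded_on_H2 beta (@mul_op R V (E i)) <->
    (ereal_sup (range (fun v : V =>
       (\sum_(u \in Chi (E i) v) (beta u ^+ 2 / beta v ^+ 2))%:E)) < +oo)%E.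
Proof.
move=> i; apply: (bounded_mul_op_iff beta_gt0 (Par_le i)) => u.
have [_ _ [m [_ [Chi_le _] _ _]]] := EX i.
by apply/finite_set_leP; exists m.
Qed.
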